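(* Let $n\ge2$ be even and $z\in\tilde I^{\mathsf{FPF}}_n$. Then $\ell(w)=\hat\ell_{\mathsf{FPF}}(z)$ for all $w\in\mathcal A^{\mathsf{FPF}}(z)$, and $\{\alpha^{\mathsf{FPF}}_{\min}(z),\alpha^{\mathsf{FPF}}_{\max}(z)\}\subset\mathcal A^{\mathsf{FPF}}(z)$.
   Context: $\tilde S_n$ is the group of bijections $\pi:\mathbb Z\to\mathbb Z$ with $\pi(i+n)=\pi(i)+n$ and $\sum_{i=1}^n\pi(i)=\sum_{i=1}^n i$, a Coxeter group with generators $s_1,\dots,s_n$ ($s_i$ swaps $i+kn,i+1+kn$ for all $k$) and length $\ell$. $\tilde I^{\mathsf{FPF}}_n$ is the set of $z\in\tilde S_n$ with $z(z(i))=i\ne z(i)$ for all $i$. With $\Theta^+=s_1s_3\cdots s_{n-1}$, $\Theta^-=s_2s_4\cdots s_n$, each $z\in\tilde I^{\mathsf{FPF}}_n$ is conjugate to exactly one $\Theta\in\{\Theta^\pm\}$, and $\mathcal A^{\mathsf{FPF}}(z)$ is the set of minimal-length elements of $\{w\in\tilde S_n:w^{-1}\Theta w=z\}$. $\hat\ell_{\mathsf{FPF}}(z)=\frac12(\ell(z)-\frac n2)$. Window notation: for integers $c_1,\dots,c_n$ representing each residue class mod $n$ exactly once, $[c_1,\dots,c_n]$ denotes the unique $\pi\in\tilde S_n$ such that $\pi(m+k)=c_k$ for $k=1,\dots,n$ for some $m\in\mathbb Z$. Let $l=n/2$, let $a_1<\dots<a_l$ be the $a\in\{1,\dots,n\}$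 with $a<z(a)$, $b_i=z(a_i)$; let $d_1<\dots<d_l$ be the $d\in\{1,\dots,n\}$ with $z(d)<d$, $c_i=z(d_i)$. Then $\alpha^{\mathsf{FPF}}_{\min}(z)=[a_1,b_1,a_2,b_2,\dots,a_l,b_l]^{-1}$ and $\alpha^{\mathsf{FPF}}_{\max}(z)=[c_1,d_1,\dots,c_l,d_l]^{-1}$. *)

(* Defs.v *)
From HB Require Import structures.
From mathcomp Require Import all_boot all_order all_algebra.
From mathcomp Require Import boolp classical_sets.
From mathcomp Require Import zify.

Set Implicit Arguments.
Unset Strict Implicit.
Unset Printing Implicit Defensive.

Import Order.TTheory GRing.Theory Num.Theory.
Local Open Scope classical_set_scope.
Local Open Scope ring_scope.

(* Bijectivity is recorded by an explicit two-sided inverse, which is unique. *)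
Record affperm (n : nat) := AffPerm {
  aff_fun :> int -> int;
  aff_inv : int -> int;
  aff_funK : cancel aff_fun aff_inv;
  aff_invK : cancel aff_inv aff_fun;
  aff_period : forall i, aff_fun (i + n%:Z) = aff_fun i + n%:Z;
  aff_sum : \sum_(1 <= i < n.+1) aff_fun i%:Z = \sum_(1 <= i < n.+1) i%:Z }.

Lemma affpermP n (f g : affperm n) : f =1 g -> f = g.
Proof.
case: f g => [f f' fK f'K pf sf] [g g' gK g'K pg sg] /= fg.
have {fg} efg : f = g by apply/funext.
move: fK f'K pf sf; rewrite efg => fK f'K pf sf.
have ef : f' = g' by apply/funext => x; apply: (can_inj gK); rewrite g'K f'K.
move: fK f'K; rewrite ef => fK f'K.
by congr AffPerm; apply: Prop_irrelevance.
Qed.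

HB.instance Definition _ n := gen_eqMixin (affperm n).
HB.instance Definition _ n := gen_choiceMixin (affperm n).

Lemma periodM (f : int -> int) (n : nat) :
  (forall i, f (i + n%:Z) = f i + n%:Z) ->
  forall (i k : int), f (i + k * n%:Z) = f i + k * n%:Z.
Proof.
move=> pf.
have H i (k : nat) : f (i + k%:Z * n%:Z) = f i + k%:Z * n%:Z.
  elim: k => [|k IH]; first by rewrite mul0r !addr0.
  by rewrite -addn1 PoszD mulrDl mul1r !addrA pf IH.
move=> i [k|k]; first exact: H.
rewrite NegzE mulNr; apply: (addIr (k.+1%:Z * n%:Z)).
by rewrite -H !subrK.
Qed.

Lemma sum_periodic (n : nat) (h g : int -> int) :
  injective g -> (forall i, g (i + n%:Z) = g i + n%:Z) ->
  (forall i, h (i + n%:Z) = h i) ->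
  \sum_(1 <= i < n.+1) h (g i%:Z) = \sum_(1 <= i < n.+1) h i%:Z.
Proof.
case: n => [|n] gI gp hp; first by rewrite !big_geq.
have hpM i k : h (i + k * n.+1%:Z) = h i.
  pose f x := h x + x.
  have fp x : f (x + n.+1%:Z) = f x + n.+1%:Z by rewrite /f hp addrA.
  by have := periodM fp i k; rewrite /f addrA => /addIr /addIr.
rewrite !big_add1 !big_mkord /=.
have lt0 : (0 : int) < n.+1%:Z by [].
pose r (i : 'I_n.+1) : 'I_n.+1 := inord `|((g i.+1%:Z - 1) %% n.+1%:Z)%Z|.
have rE i : (r i)%:Z = ((g i.+1%:Z - 1) %% n.+1%:Z)%Z.
  have ge0 := modz_ge0 (g i.+1%:Z - 1) (lt0r_neq0 lt0).
  have ltn := ltz_pmod (g i.+1%:Z - 1) lt0.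
  by rewrite inordK; lia.
have rI : injective r.
  move=> i j rij; have := divz_eq (g i.+1%:Z - 1) n.+1%:Z.
  have := divz_eq (g j.+1%:Z - 1) n.+1%:Z.
  rewrite -!rE rij; set a := (_ %/ _)%Z; set b := (_ %/ _)%Z => ej ei.
  have : g (i.+1%:Z) = g (j.+1%:Z + (b - a) * n.+1%:Z).
    by rewrite periodM // mulrBl; lia.
  move/gI; have := ltn_ord i; have := ltn_ord j; move: (b - a) => k li lj e.
  have k0 : k = 0 by nia.
  by apply/val_inj => /=; rewrite k0 in e; lia.
rewrite [RHS](reindex_inj rI) /=; apply: eq_bigr => i _.
have e := divz_eq (g i.+1%:Z - 1) n.+1%:Z; rewrite -rE in e.
rewrite -[RHS](hpM _ ((g i.+1%:Z - 1) %/ n.+1%:Z)%Z); congr h.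
by rewrite -[in RHS]addn1 PoszD; lia.
Qed.

Section Group.
Variable n : nat.
Implicit Types f g : affperm n.

Lemma aff_disp f i : f (i + n%:Z) - (i + n%:Z) = f i - i.
Proof. by rewrite aff_period; lia. Qed.

Lemma aff_dispE f : \sum_(1 <= i < n.+1) (f i%:Z - i%:Z) = 0.
Proof. by rewrite sumrB aff_sum subrr. Qed.

Definition aff_one : affperm n.
Proof. by exists id id. Defined.

Definition aff_mul f g : affperm n.
Proof.
exists (f \o g) (aff_inv g \o aff_inv f).
- exact: can_comp (aff_funK f) (aff_funK g).
- exact: can_comp (aff_invK g) (aff_invK f).
- by move=> i; rewrite /= !aff_period.
- apply/eqP; rewrite -subr_eq0 -sumrB; apply/eqP.
  rewrite (eq_bigr (fun i : nat => (f (g i%:Z) - g i%:Z) + (g i%:Z - i%:Z)));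
    last by move=> i _ /=; lia.
  rewrite big_split /= aff_dispE addr0.
  rewrite (sum_periodic (h := fun x => f x - x)) ?aff_dispE //.
  + exact: can_inj (aff_funK g).
  + exact: aff_period.
  + exact: aff_disp.
Defined.

Lemma aff_inv_period f i : aff_inv f (i + n%:Z) = aff_inv f i + n%:Z.
Proof.
by apply: (can_inj (aff_funK f)); rewrite aff_period !aff_invK.
Qed.

Definition aff_invg f : affperm n.
Proof.
exists (aff_inv f) f.
- exact: aff_invK.
- exact: aff_funK.
- exact: aff_inv_period.
- have := sum_periodic (h := fun x => f x - x) (can_inj (aff_invK f))
    (aff_inv_period f) (aff_disp f).
  rewrite aff_dispE => e; apply/eqP; rewrite -subr_eq0 -oppr_eq0 -sumrB -sumrN.
  apply/eqP; rewrite -[RHS]e; apply: eq_bigr => i _.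
  by rewrite aff_invK opprB.
Defined.

Lemma aff_mulA : associative aff_mul.
Proof. by move=> f g h; apply: affpermP. Qed.
Lemma aff_mul1 : left_id aff_one aff_mul.
Proof. by move=> f; apply: affpermP. Qed.
Lemma aff_mulr1 : right_id aff_one aff_mul.
Proof. by move=> f; apply: affpermP. Qed.
Lemma aff_mulV : left_inverse aff_one aff_invg aff_mul.
Proof. by move=> f; apply: affpermP => x; apply: aff_funK. Qed.
Lemma aff_mulVr : right_inverse aff_one aff_invg aff_mul.
Proof. by move=> f; apply: affpermP => x; apply: aff_invK. Qed.

End Group.

(* The product is composition of maps: [(f * g)%g x = f (g x)]. *)
HB.instance Definition _ n := isGroup.Build (affperm n)
  (@aff_mulA n) (@aff_mul1 n) (@aff_mulr1 n) (@aff_mulV n) (@aff_mulVr n).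

Lemma aff_mulE n (f g : affperm n) x : (f * g)%g x = f (g x).
Proof. by []. Qed.
Lemma aff_oneE n x : (1%g : affperm n) x = x.
Proof. by []. Qed.
Lemma aff_invE n (f : affperm n) x : (f^-1)%g x = aff_inv f x.
Proof. by []. Qed.

(* Adds 1 on the class of i and subtracts 1 on the class of i + 1.  If n = 1
   the two classes coincide and this is the identity. *)
Definition srefl_fun (n i : nat) (x : int) : int :=
  x + (n %| x - i%:Z)%Z%:Z - (n %| x - i.+1%:Z)%Z%:Z.

Lemma srefl_funK n i : involutive (srefl_fun n i).
Proof.
have [->|n1] := eqVneq n 1%N.
  by move=> x; rewrite /srefl_fun !dvd1z; lia.
have nd1 : (n %| 1)%Z = false by rewrite dvdz1 /=; apply/eqP/eqP; lia.
have nd (u : int) : (n %| u)%Z -> (n %| u + 1)%Z = false.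
  by move=> du; rewrite rpredDl.
have nd' (u : int) : (n %| u)%Z -> (n %| u - 1)%Z = false.
  by move=> du; rewrite rpredDl // rpredN.
move=> x; pose y := x - i.+1%:Z.
have fE (k : int) : srefl_fun n i (x + k) =
    x + k + (n %| y + k + 1)%Z%:Z - (n %| y + k)%Z%:Z.
  rewrite /srefl_fun; have -> : x + k - i%:Z = y + k + 1 by rewrite /y; lia.
  by have -> : x + k - i.+1%:Z = y + k by rewrite /y; lia.
have := fE 0; rewrite !addr0 => ->.
have [d0|d0] := boolP (n %| y)%Z.
  rewrite (nd _ d0) addr0 fE subrK (nd' _ d0) d0; lia.
have [d1|d1] := boolP (n %| y + 1)%Z.
  by rewrite subr0 fE (nd _ d1) d1; lia.
rewrite subr0 fE !addr0 (negbTE d0) (negbTE d1); lia.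
Qed.

Lemma dvdz_period (n : nat) (x : int) : (n %| x + n%:Z)%Z = (n %| x)%Z.
Proof. by rewrite rpredDr ?dvdzz. Qed.

Definition srefl (n i : nat) : affperm n.
Proof.
exists (srefl_fun n i) (srefl_fun n i).
- exact: srefl_funK.
- exact: srefl_funK.
- move=> x; rewrite /srefl_fun.
  rewrite ![x + n%:Z - _]addrAC !dvdz_period; lia.
- pose h (x : int) : int := (n %| x - i%:Z)%Z%:Z.
  rewrite /srefl_fun sumrB big_split /=.
  rewrite -(@sum_periodic n h (fun x => x - 1)).
  + rewrite -addrA -sumrB [X in _ + X]big1_seq ?addr0 // => j _; rewrite /h.
    have -> : j%:Z - 1 - i%:Z = j%:Z - i.+1%:Z by lia.
    by rewrite subrr.
  + exact: addIr.
  + by move=> x; lia.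
  + by move=> x; rewrite /h addrAC dvdz_period.
Defined.

Lemma srefl_l n i (k : int) : (1 < n)%N ->
  srefl n i (i%:Z + k * n%:Z) = i.+1%:Z + k * n%:Z.
Proof.
move=> n1; rewrite /= /srefl_fun.
have -> : i%:Z + k * n%:Z - i%:Z = k * n%:Z by lia.
have -> : i%:Z + k * n%:Z - i.+1%:Z = k * n%:Z - 1 by lia.
rewrite dvdz_mull // rpredDl ?dvdz_mull // rpredN dvdz1 /=.
by case: eqP => ?; lia.
Qed.

Lemma srefl_r n i (k : int) : (1 < n)%N ->
  srefl n i (i.+1%:Z + k * n%:Z) = i%:Z + k * n%:Z.
Proof.
move=> n1; rewrite -(srefl_l i k n1); exact: srefl_funK.
Qed.

Lemma srefl_id (n i : nat) (x : int) :
  ~~ (n %| x - i%:Z)%Z -> ~~ (n %| x - i.+1%:Z)%Z -> srefl n i x = x.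
Proof. by move=> h1 h2; rewrite /= /srefl_fun (negbTE h1) (negbTE h2); lia. Qed.

Section FPF.
Variable n : nat.
Implicit Types w z p : affperm n.

Definition is_word_length p (k : nat) : Prop :=
  exists2 s : seq 'I_n, size s = k & (\prod_(i <- s) srefl n i.+1)%g = p.

(* The minimum exists because the s_i generate the group when 2 <= n. *)
Definition ell p : nat :=
  xget 0%N [set k | is_word_length p k /\
                    forall j, is_word_length p j -> (k <= j)%N].

Definition fpf_involutions : set (affperm n) :=
  [set z | forall i, z (z i) = i /\ i <> z i].

Definition Theta_plus : affperm n :=
  (\prod_(i < n./2) srefl n i.*2.+1)%g.

Definition Theta_minus : affperm n :=
  (\prod_(i < n./2) srefl n i.*2.+2)%g.

(* At most one of the two choices of Theta is conjugate to a given z. *)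
Definition atoms_fpf z : set (affperm n) :=
  [set w | exists2 Theta, Theta \in [:: Theta_plus; Theta_minus] &
     (w^-1 * Theta * w)%g = z /\
     forall v, (v^-1 * Theta * v)%g = z -> (ell w <= ell v)%N].

Definition ellhat_fpf z : rat := ((ell z)%:R - n%:R / 2) / 2.

(* [c] lists c_1, ..., c_n, so that c_(k+1) is [nth 0 c k]. *)
Definition window (c : seq int) : affperm n :=
  xget 1%g [set p : affperm n | exists m : int,
    forall k, (k < n)%N -> p (m + k.+1%:Z) = nth 0 c k].

Definition interval1n : seq int := [seq i%:Z | i <- iota 1 n].

Definition alpha_min_fpf z : affperm n :=
  ((window (flatten [seq [:: a; z a] | a <- interval1n & a < z a]))^-1)%g.

Definition alpha_max_fpf z : affperm n :=
  ((window (flatten [seq [:: z d; d] | d <- interval1n & z d < d]))^-1)%g.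

End FPF.

(* Main.v *)
(* Put F p x y = floor((p x - p y)/n) and let dist f g be the sum of
   |F f x y - F g x y| over pairs of residue classes x, y.  This is a
   right-invariant pseudometric on the affine permutations, and
   dist 1 p = 2 ell p.  If z = v Theta v^-1, then
   dist 1 z = dist v (v Theta), and the triangle inequality along
   v, 1, Theta, v Theta gives ell z <= 2 ell v + n/2.  For the windows
   v = [a_1,b_1,...] and v = [c_1,d_1,...] the four numbers F v, F 1, F Theta,
   F (v Theta) are monotone at each pair x, y, so equality holds.  A minimal
   w for either Theta reaches this bound, because the two Thetas are not
   conjugate: a conjugation between them would change the sum of a window
   modulo 2n. *)
Require Import Defs.
From mathcomp Require Import all_boot all_order all_algebra.
From mathcomp Require Import boolp classical_sets.
From mathcomp Require Import zify lra.
Import Order.TTheory GRing.Theory Num.Theory.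
Local Open Scope classical_set_scope.
Local Open Scope ring_scope.

(** * Floor differences and their behaviour under shifts and exchange *)

Definition fldiff (n : nat) (x y : int) : int := ((x - y) %/ n%:Z)%Z.

Section AffinePermutations.
Variables (n : nat) (n_gt1 : (1 < n)%N).
Let n_gt0 : (0 < n)%N := ltnW n_gt1.
Implicit Types x y : int.

Lemma fldiff_lt0 x y : (fldiff n x y < 0) = (x < y).
Proof. rewrite /fldiff ltz_divLR ?ltz_nat //; lia. Qed.

Lemma fldiff_geN1 x y : (-1 <= fldiff n x y) = (y <= x + n%:Z).
Proof. rewrite /fldiff lez_divRL ?ltz_nat //; lia. Qed.

Lemma fldiff_ge1 x y : (1 <= fldiff n x y) = (y + n%:Z <= x).
Proof. rewrite /fldiff lez_divRL ?ltz_nat //; lia. Qed.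

Lemma fldiff_small x y : y < x + n%:Z -> x < y + n%:Z ->
  fldiff n x y = - (x < y)%R%:Z.
Proof.
move=> h1 h2; have := fldiff_lt0 x y; have := fldiff_geN1 x y.
have := fldiff_ge1 x y; lia.
Qed.

Lemma fldiffDl x y : fldiff n (x + n%:Z) y = fldiff n x y + 1.
Proof.
have -> : fldiff n (x + n%:Z) y = ((1 * n%:Z + (x - y)) %/ n%:Z)%Z.
  by rewrite /fldiff; congr (_ %/ _)%Z; lia.
by rewrite divzMDl 1?addrC //; lia.
Qed.

Lemma fldiffDr x y : fldiff n x (y + n%:Z) = fldiff n x y - 1.
Proof. by rewrite -{2}[x](subrK n%:Z) fldiffDl addrK /fldiff opprD addrA addrAC. Qed.

(** For a real t that is not an integer, floor(-t) = -1 - floor(t). *)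
Lemma fldiff_swap x y : ~~ (n %| x - y)%Z -> fldiff n y x = -1 - fldiff n x y.
Proof.
rewrite /fldiff => nd; rewrite -(opprB x y).
have n0 : (n%:Z != 0) by lia.
have := divz_eq (x - y) n; have := ltz_pmod (x - y) (d := n).
have := modz_ge0 (x - y) n0.
have : ((x - y) %% n)%Z != 0 by apply/eqP => /dvdz_mod0P; apply/negP.
move: (_ %% _)%Z (_ %/ _)%Z => r q r0 h1 h2 ->.
have h3 : r < n%:Z by apply: h2; lia.
have -> : - (q * n%:Z + r) = (-1 - q) * n%:Z + (n%:Z - r) by lia.
rewrite divzMDl // divz_small; lia.
Qed.

(** * The right-invariant pseudometric [dist] *)

Implicit Types f g h p : affperm n.

Definition disc f g (x y : int) : int :=
  `|fldiff n (f x) (f y) - fldiff n (g x) (g y)|.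

(* A right-invariant pseudometric; [dist 1 p] is twice the number of inversions
   of [p] modulo shifts, since [disc 1 p x y] counts the translates of [y] that
   are inverted with [x]. *)
Definition dist f g : int :=
  \sum_(1 <= x < n.+1) \sum_(1 <= y < n.+1) disc f g x%:Z y%:Z.

Lemma aff_inj f : injective f.
Proof. exact: can_inj (aff_funK f). Qed.

Lemma disc_ge0 f g x y : 0 <= disc f g x y.
Proof. exact: normr_ge0. Qed.

Lemma discC f g x y : disc f g x y = disc g f x y.
Proof. exact: distrC. Qed.

Lemma discPl f g x y : disc f g (x + n%:Z) y = disc f g x y.
Proof.
by rewrite /disc !aff_period !fldiffDl //; congr `|_|; lia.
Qed.

Lemma discPr f g x y : disc f g x (y + n%:Z) = disc f g x y.
Proof.
by rewrite /disc !aff_period !fldiffDr //; congr `|_|; lia.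
Qed.

(** [disc] is n-periodic in each argument and [h] permutes the classes modulo n, so each of the two
    sums can be reindexed separately. *)
Lemma dist_reindex f g (h : int -> int) : injective h ->
  (forall i, h (i + n%:Z) = h i + n%:Z) ->
  dist f g = \sum_(1 <= x < n.+1) \sum_(1 <= y < n.+1)
    disc f g (h x%:Z) (h y%:Z).
Proof.
move=> hI hp; rewrite /dist.
rewrite -(sum_periodic (h := fun x => \sum_(1 <= y < n.+1) disc f g x y%:Z) hI hp).
  apply: eq_bigr => x _.
  rewrite -(sum_periodic (h := fun y => disc f g (h x%:Z) y) hI hp) // => y.
  exact: discPr.
by move=> x; apply: eq_bigr => y _; apply: discPl.
Qed.

Lemma dist_shift f g (m : int) : dist f g =
  \sum_(1 <= x < n.+1) \sum_(1 <= y < n.+1) disc f g (m + x%:Z) (m + y%:Z).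
Proof.
by apply: (dist_reindex f g (+%R m)) => [|i]; [apply: addrI | apply: addrA].
Qed.

Lemma dist_mulr f g h : dist (f * h)%g (g * h)%g = dist f g.
Proof.
rewrite [RHS](dist_reindex f g h) //; first exact: aff_inj.
exact: aff_period.
Qed.

Lemma distC f g : dist f g = dist g f.
Proof. by apply: eq_bigr => x _; apply: eq_bigr => y _; apply: discC. Qed.

Lemma distff f : dist f f = 0.
Proof. by rewrite /dist big1 // => x _; rewrite big1 // => y _; rewrite /disc subrr. Qed.

Lemma dist_ge0 f g : 0 <= dist f g.
Proof. by apply: sumr_ge0 => x _; apply: sumr_ge0 => y _; apply: disc_ge0. Qed.

Lemma dist_triangle f g h : dist f h <= dist f g + dist g h.
Proof.
rewrite /dist -big_split; apply: ler_sum => x _ /=.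
rewrite -big_split; apply: ler_sum => y _ /=; exact: ler_distD.
Qed.

Lemma dist1V p : dist 1%g (p^-1)%g = dist 1%g p.
Proof. by rewrite -(dist_mulr _ _ p) mulVg mul1g distC. Qed.

Lemma dist1M f g : dist 1%g (f * g)%g <= dist 1%g f + dist 1%g g.
Proof.
by rewrite addrC -(dist_mulr 1%g f g) mul1g dist_triangle.
Qed.

(** * Descents, and the identity between [dist 1 p] and twice the length *)

Lemma sum_first2 (G : nat -> int) : 
  (forall x : nat, (2 < x <= n)%N -> G x = 0) ->
  \sum_(1 <= x < n.+1) G x = G 1%N + G 2%N.
Proof.
move=> G0; rewrite big_ltn ?ltnS // big_ltn ?ltnS //; congr (_ + _).
by rewrite big1_seq ?addr0 // => x /=; rewrite mem_index_iota ltnS; apply: G0.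
Qed.

Lemma ndvdz_small (u q : int) :
  u != 0 -> - n%:Z < u -> u < n%:Z -> ~~ (n %| u + q * n%:Z)%Z.
Proof.
move=> u0 nu un; rewrite rpredDr ?dvdz_mull //.
apply/negP => /dvdzP [r e]; rewrite e in u0 nu un.
by case: (ltrgtP r 0) => r0; [nia|nia|rewrite r0 mul0r in u0].
Qed.

Lemma srefl_far (i : nat) x q :
  x != i%:Z -> x != i.+1%:Z -> i.+1%:Z - n%:Z < x -> x < i%:Z + n%:Z ->
  srefl n i (x + q * n%:Z) = x + q * n%:Z.
Proof.
by move=> *; apply: srefl_id; rewrite addrAC ndvdz_small //; lia.
Qed.

Lemma srefl_offset (i : nat) (x : nat) : (0 < x <= n)%N ->
  srefl n i.+1 (i%:Z + x%:Z) =
  i%:Z + (if x == 1%N then 2 else if x == 2%N then 1 else x)%N%:Z.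
Proof.
move=> hx.
have [->|x1] := eqVneq x 1%N.
  have := srefl_l i.+1 0 n_gt1; rewrite mul0r !addr0.
  have -> : i%:Z + 1%N%:Z = i.+1%:Z by lia.
  by move=> ->; lia.
have [->|x2] := eqVneq x 2%N.
  have := srefl_r i.+1 0 n_gt1; rewrite mul0r !addr0.
  have -> : i%:Z + 2%N%:Z = i.+2%:Z by lia.
  by move=> ->; lia.
have := srefl_far i.+1 (i%:Z + x%:Z) 0; rewrite mul0r addr0 => -> //; lia.
Qed.

Lemma sreflK (i : nat) : (srefl n i * srefl n i)%g = 1%g.
Proof. by apply: affpermP => x; apply: srefl_funK. Qed.

Lemma aff_ndvd p x y : ~~ (n %| x - y)%Z -> ~~ (n %| p x - p y)%Z.
Proof.
apply: contra => /dvdzP [q e]; apply/dvdzP; exists q.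
have : p x = p (y + q * n%:Z).
  by rewrite (periodM (@aff_period n p)) -e; lia.
by move/aff_inj => ->; lia.
Qed.

(** By right invariance the left side is [dist s p]. F 1 and F s differ only at the two ordered
    pairs formed by the classes of i+1 and i+2, and at each of them the descent makes s closer to p
    than 1 by exactly one. *)
Lemma dist_descent p (i : nat) : 
  p i.+2%:Z < p i.+1%:Z ->
  dist 1%g (p * srefl n i.+1)%g = dist 1%g p - 2.
Proof.
move=> lt_p; set s := srefl n i.+1.
rewrite -{1}(sreflK i.+1) dist_mulr -/s.
apply/eqP; rewrite eq_sym subr_eq addrC -subr_eq; apply/eqP.
rewrite !(dist_shift _ _ i%:Z) -sumrB.
have sE (x : nat) : (0 < x <= n)%N -> s (i%:Z + x%:Z) = _ := srefl_offset i x.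
(* Within one block of n integers F only records which entry is smaller, and exchanging the first
   two offsets alters no other comparison. *)
have H0 (x y : nat) : (0 < x <= n)%N -> (0 < y <= n)%N ->
    ~~ ((x == 1%N) && (y == 2%N)) -> ~~ ((x == 2%N) && (y == 1%N)) ->
    disc 1%g p (i%:Z + x%:Z) (i%:Z + y%:Z) =
    disc s p (i%:Z + x%:Z) (i%:Z + y%:Z).
  move=> hx hy h1 h2; rewrite /disc !sE // !aff_oneE.
  have [->|xy] := eqVneq x y; first by rewrite /fldiff !subrr.
  congr `|_ - _|; move: hx hy xy h1 h2.
  by case: (eqVneq x 1%N); case: (eqVneq x 2%N); case: (eqVneq y 1%N);
    case: (eqVneq y 2%N) => *; rewrite !fldiff_small; lia.
have nd : ~~ (n %| i.+2%:Z - i.+1%:Z)%Z.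
  have -> : i.+2%:Z - i.+1%:Z = 1 by lia.
  by rewrite dvdz1 /=; apply/eqP; lia.
have sw := fldiff_swap _ _ (aff_ndvd p _ _ nd).
have lt0 := fldiff_lt0 (p i.+2%:Z) (p i.+1%:Z).
have e1 : i%:Z + 1%N%:Z = i.+1%:Z by lia.
have e2 : i%:Z + 2%N%:Z = i.+2%:Z by lia.
have H12 : disc 1%g p (i%:Z + 1%N%:Z) (i%:Z + 2%N%:Z) -
    disc s p (i%:Z + 1%N%:Z) (i%:Z + 2%N%:Z) = 1.
  rewrite /disc !sE //= e1 e2.
  rewrite [fldiff n i.+1%:Z _]fldiff_small ?[fldiff n i.+2%:Z _]fldiff_small; lia.
have H21 : disc 1%g p (i%:Z + 2%N%:Z) (i%:Z + 1%N%:Z) -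
    disc s p (i%:Z + 2%N%:Z) (i%:Z + 1%N%:Z) = 1.
  rewrite /disc !sE //= e1 e2.
  rewrite [fldiff n i.+1%:Z _]fldiff_small ?[fldiff n i.+2%:Z _]fldiff_small; lia.
rewrite sum_first2 //; last first.
  move=> x hx; rewrite -sumrB big1_seq // => y /=.
  by rewrite mem_index_iota => hy; rewrite H0 ?subrr //; lia.
rewrite -!sumrB !sum_first2 ?H12 ?H21 ?H0 //.
- by rewrite !subrr.
- by move=> x hx; rewrite H0 ?subrr //; lia.
- by move=> x hx; rewrite H0 ?subrr //; lia.
Qed.

Lemma dist_srefl (i : nat) : dist 1%g (srefl n i.+1) = 2.
Proof.
have lt_s : srefl n i.+1 i.+2%:Z < srefl n i.+1 i.+1%:Z.
  have := srefl_l i.+1 0 n_gt1; have := srefl_r i.+1 0 n_gt1.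
  by rewrite mul0r !addr0 => -> ->; lia.
have := dist_descent _ _ lt_s; rewrite sreflK distff; lia.
Qed.

Lemma dist_prod (I : Type) (s : seq I) (F : I -> nat) : 
  dist 1%g (\prod_(i <- s) srefl n (F i).+1)%g <= 2 * (size s)%:Z.
Proof.
elim: s => [|i s IH]; first by rewrite big_nil distff.
rewrite big_cons; apply: (le_trans (dist1M _ _)).
rewrite dist_srefl; move: IH; move: (dist _ _) => d; rewrite [size (_ :: _)]/=; lia.
Qed.

(** Periodicity makes p increasing on all integers. Its n strict steps over one period add up to n,
    so each step is 1 and p is a translation; the sum condition makes the translation trivial. *)
Lemma no_descent p : 
  (forall i : 'I_n, p i.+1%:Z < p i.+2%:Z) -> p = 1%g.
Proof.
move=> asc.
have {}asc x : p x < p (x + 1).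
  have e := divz_eq (x - 1) n%:Z.
  have r0 : 0 <= ((x - 1) %% n)%Z by apply: modz_ge0; lia.
  have rn : ((x - 1) %% n)%Z < n%:Z by apply: ltz_pmod; lia.
  rewrite -(gez0_abs r0) in e rn.
  have hr : (`|((x - 1) %% n)%Z| < n)%N by lia.
  have lt_p := asc (Ordinal hr); rewrite [nat_of_ord _]/= in lt_p.
  move: ((x - 1) %/ n)%Z `|((x - 1) %% n)%Z|%N e rn hr lt_p => k r e rn hr.
  have [-> ->] : x = r.+1%:Z + k * n%:Z /\ x + 1 = r.+2%:Z + k * n%:Z by lia.
  by rewrite !(periodM (@aff_period n p)); lia.
have ge x (k : nat) : p x + k%:Z <= p (x + k%:Z).
  elim: k => [|k IH]; first by rewrite !addr0.
  have -> : x + k.+1%:Z = x + k%:Z + 1 by lia.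
  by have := asc (x + k%:Z); lia.
have eq1 x : p (x + 1) = p x + 1.
  have := asc x; have := ge (x + 1) n.-1.
  have -> : x + 1 + n.-1%:Z = x + n%:Z by lia.
  rewrite aff_period; lia.
have eqk x (k : nat) : p (x + k%:Z) = p x + k%:Z.
  elim: k => [|k IH]; first by rewrite !addr0.
  have -> : x + k.+1%:Z = x + k%:Z + 1 by lia.
  by rewrite eq1 IH; lia.
have p0 : p 0 = 0.
  have := aff_dispE p; rewrite (eq_bigr (fun=> p 0)); last first.
    by move=> k _; have := eqk 0 k; rewrite add0r; lia.
  rewrite sumr_const_nat; lia.
apply: affpermP => -[k|k]; first by rewrite -[Posz k]add0r eqk p0.
have := eqk (Negz k) k.+1; rewrite NegzE addNr p0 aff_oneE; lia.
Qed.

(** Each descent strips off one generator and lowers the distance by 2; when no descent is left the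
    remaining element is the identity. *)
Lemma dist_word p : 
  exists2 s : seq 'I_n, 2 * (size s)%:Z <= dist 1%g p &
    (\prod_(i <- s) srefl n i.+1)%g = p.
Proof.
have [k] := ubnP `|dist 1%g p|%N; elim: k p => // k IH p lek.
have [asc|] := pselect (forall i : 'I_n, p i.+1%:Z < p i.+2%:Z).
  by exists [::]; rewrite ?big_nil ?dist_ge0 // (no_descent p).
case/existsNP => i /negP; rewrite -leNgt => lep.
have lt_p : p i.+2%:Z < p i.+1%:Z.
  by rewrite lt_neqAle lep andbT; apply/eqP => /aff_inj; lia.
have dE := dist_descent _ _ lt_p.
have d0 := dist_ge0 1%g (p * srefl n i.+1)%g.
have [|s les sE] := IH (p * srefl n i.+1)%g; first by rewrite dE in d0 *; lia.
exists (rcons s i); first by rewrite size_rcons; lia.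
by rewrite -cats1 big_cat big_seq1 /= sE -mulgA sreflK mulg1.
Qed.

Lemma dist_ell p : dist 1%g p = 2 * (ell p)%:Z.
Proof.
have [s les sE] := dist_word p.
have lb j : is_word_length p j -> dist 1%g p <= 2 * j%:Z.
  by case=> t <- <-; apply: (dist_prod _ t (fun i : 'I_n => i : nat)).
have ws : is_word_length p (size s) by exists s.
have hs : 2 * (size s)%:Z = dist 1%g p by apply/eqP; rewrite eq_le les lb.
rewrite /ell -hs; case: xgetP => [k _ [wk mk]|].
  by have := lb _ wk; have := mk _ ws; lia.
(* The default value of [xget] cannot occur: the word [s] attains the minimum. *)
move/(_ (size s)) => h; exfalso; apply: h; split=> // j wj.
have := lb _ wj; lia.
Qed.

(** Both floors turn into -1 minus themselves. This reduces later comparisons to x < y. *)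
Lemma discS f g x y : ~~ (n %| x - y)%Z -> disc f g y x = disc f g x y.
Proof.
move=> nd; rewrite /disc (fldiff_swap (f x)) ?aff_ndvd // (fldiff_swap (g x)) ?aff_ndvd //.
by rewrite [RHS]distrC; congr `|_|; lia.
Qed.

Lemma discxx f g x : disc f g x x = 0.
Proof. by rewrite /disc /fldiff !subrr. Qed.

(** * The two involutions Theta and their distance from the identity *)

Hypothesis n_even : ~~ odd n.
Let l := n./2.
Let n2l : n = (2 * l)%N.
Proof. by rewrite mul2n /l even_halfK. Qed.

(** The boolean is the parity shift: [theta b] swaps x - 1 and x for every x congruent to b modulo
    2. *)
Definition theta (b : bool) : affperm n :=
  if b then Theta_minus n else Theta_plus n.

Lemma thetaE b :
  theta b = (\prod_(0 <= i < l) srefl n (2 * i + b).+1)%g.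
Proof.
rewrite big_mkord; by case: b; apply: eq_bigr => i _; rewrite mul2n ?addn0 ?addn1.
Qed.

Lemma dist1_theta_le b : dist 1%g (theta b) <= n%:Z.
Proof.
rewrite thetaE; apply: (le_trans (dist_prod _ _ _)).
by rewrite size_iota subn0 n2l; lia.
Qed.

Lemma prod_srefl_recr (b k : nat) x :
  (\prod_(0 <= i < k.+1) srefl n (2 * i + b).+1)%g x =
  (\prod_(0 <= i < k) srefl n (2 * i + b).+1)%g (srefl n (2 * k + b).+1 x).
Proof. by rewrite big_nat_recr. Qed.

(** The hypothesis places x strictly above each swapped pair but below its next translate, so no
    factor moves x. *)
Lemma prod_srefl_far (b k : nat) x : (k <= l)%N ->
  (forall i : nat, (i < k)%N ->
     0 < x - (2 * i + b).+2%:Z /\ x - (2 * i + b).+1%:Z < n%:Z) ->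
  forall q, (\prod_(0 <= i < k) srefl n (2 * i + b).+1)%g (x + q * n%:Z) =
    x + q * n%:Z.
Proof.
move=> kl far q; elim: k kl far => [|k IH] kl far; first by rewrite big_geq.
rewrite prod_srefl_recr srefl_far; try by have := far k; lia.
by apply: IH => [|i ik]; [lia|apply: far; lia].
Qed.

Lemma prod_srefl_pair (b k j : nat) (q : int) : (j < k <= l)%N ->
  let s := (\prod_(0 <= i < k) srefl n (2 * i + b).+1)%g in
  s ((2 * j + b).+1%:Z + q * n%:Z) = (2 * j + b).+2%:Z + q * n%:Z /\
  s ((2 * j + b).+2%:Z + q * n%:Z) = (2 * j + b).+1%:Z + q * n%:Z.
Proof.
elim: k => [|k IH] // hk s; rewrite /s !prod_srefl_recr.
have [ejk|njk] := eqVneq j k.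
  rewrite -ejk srefl_l // srefl_r //.
  by split; apply: prod_srefl_far; try lia; move=> i hi; lia.
by rewrite !srefl_far; try lia; apply: IH; lia.
Qed.

Lemma sum_pairs (F : nat -> int) (k : nat) :
  \sum_(1 <= i < (2 * k).+1) F i =
  \sum_(1 <= i < k.+1) (F (2 * i).-1 + F (2 * i)%N).
Proof.
elim: k => [|k IH]; first by rewrite !big_geq.
have e : (2 * k.+1 = (2 * k).+2)%N by lia.
rewrite [RHS]big_nat_recr // -IH e /=.
by rewrite big_nat_recr //= big_nat_recr //= addrA.
Qed.

Lemma thetaP (b : bool) (u : int) :
  theta b (2 * u + b%:Z) = 2 * u + b%:Z - 1 /\
  theta b (2 * u + b%:Z - 1) = 2 * u + b%:Z.
Proof.
have l_gt0 : (0 < l)%N by lia.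
(* Writing u = q l + j + 1, the factor of index j performs the swap, translated by q periods. *)
have e := divz_eq (u - 1) l%:Z.
have r0 : 0 <= ((u - 1) %% l)%Z by apply: modz_ge0; lia.
have rl : ((u - 1) %% l)%Z < l%:Z by apply: ltz_pmod; lia.
rewrite -(gez0_abs r0) in e rl.
move: ((u - 1) %/ l)%Z `|((u - 1) %% l)%Z|%N e rl => q j e rl.
have := prod_srefl_pair b l j q; rewrite -thetaE.
have -> : (2 * j + b).+1%:Z + q * n%:Z = 2 * u + b%:Z - 1 by rewrite n2l; lia.
have -> : (2 * j + b).+2%:Z + q * n%:Z = 2 * u + b%:Z by rewrite n2l; lia.
by case=> [|-> ->]; [lia|].
Qed.

Lemma theta_step (b : bool) x : (2 %| x - b%:Z)%Z ->
  theta b x = x - 1 /\ theta b (x - 1) = x.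
Proof.
case/dvdzP => u e; have -> : x = 2 * u + b%:Z by lia.
exact: thetaP.
Qed.

Lemma parityP (b : bool) x : (2 %| x - b%:Z)%Z \/ (2 %| x + 1 - b%:Z)%Z.
Proof. by case: b => /=; lia. Qed.

Lemma thetaK b x : theta b (theta b x) = x.
Proof.
case: (parityP b x) => /theta_step [e1 e2]; first by rewrite e1 e2.
by rewrite addrK in e1 e2; rewrite e2 e1.
Qed.

Lemma theta_adj b x : theta b x = x - 1 \/ theta b x = x + 1.
Proof.
case: (parityP b x) => /theta_step [e1 e2]; first by left.
by rewrite addrK in e1 e2; right.
Qed.

(** The word of l generators gives the upper bound. For the lower bound, each x contributes at least
    1 through its partner [theta b x]. *)
Lemma dist1_theta b : dist 1%g (theta b) = n%:Z.
Proof.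
apply/eqP; rewrite eq_le dist1_theta_le /=.
have -> : n%:Z = \sum_(1 <= x < n.+1) 1 by rewrite sumr_const_nat; lia.
rewrite /dist; apply: ler_sum_nat => x hx.
(* The partner of x may lie outside 1..n; reindexing by [theta b] places it at the index y = x. *)
rewrite -(sum_periodic (h := fun y => disc 1%g (theta b) x%:Z y)
  (aff_inj (theta b)) (@aff_period _ (theta b))); last by move=> y; apply: discPr.
rewrite (bigD1_seq x) ?mem_index_iota ?iota_uniq //=.
apply: (@le_trans _ _ (disc 1%g (theta b) x%:Z (theta b x%:Z))); last first.
  by rewrite lerDl; apply: sumr_ge0 => y _; apply: disc_ge0.
rewrite /disc thetaK; case: (theta_adj b x%:Z) => ->;
  rewrite !aff_oneE !fldiff_small; lia.
Qed.

(* u sends the pair {2k-1, 2k} to a pair {2 J k, 2 J k + 1}, where J permutes the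
   classes modulo l; comparing the window sum of u with that of the identity
   gives 4 q l + 2 l = 0 for some q. *)
Lemma theta_not_conj (u : affperm n) : (u * theta false)%g <> (theta true * u)%g.
Proof.
move=> e.
have l_gt0 : (0 < l)%N by lia.
have {}e x : u (theta false x) = theta true (u x).
  by rewrite -!aff_mulE e.
(* Either of 2 J k and 2 J k + 1 has quotient J k, so the order within the image pair is
   irrelevant. *)
pose J (k : int) : int := (u (2 * k - 1) %/ 2)%Z.
have uJ (k : int) : u (2 * k - 1) + u (2 * k) = 4 * J k + 1 /\
    (u (2 * k - 1) = 2 * J k \/ u (2 * k) = 2 * J k).
  have [_ ek] := thetaP false k; rewrite addr0 in ek.
  have := e (2 * k - 1); rewrite ek => ->; rewrite /J.
  case: (parityP true (u (2 * k - 1))) => /[dup] h /theta_step [e1 e2].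
    by rewrite e1; move: (u _) h => y /dvdzP [r h]; rewrite /= in h; split; lia.
  rewrite addrK in e2; rewrite e2.
  by move: (u _) h => y /dvdzP [r h]; rewrite /= in h; split; lia.
have Jp (k : int) : J (k + l%:Z) = J k + l%:Z.
  rewrite /J; have -> : 2 * (k + l%:Z) - 1 = 2 * k - 1 + n%:Z by rewrite n2l; lia.
  by rewrite aff_period; lia.
clearbody J.
have JI : injective J.
  move=> k k' ejk; have [s1 c1] := uJ k; have [s2 c2] := uJ k'; rewrite ejk in s1 c1.
  case: c1 c2 => [c1|c1] [c2|c2].
  - have /aff_inj : u (2 * k - 1) = u (2 * k' - 1) by rewrite c1 c2.
    lia.
  - have /aff_inj : u (2 * k - 1) = u (2 * k') by rewrite c1 c2.
    lia.
  - have /aff_inj : u (2 * k) = u (2 * k' - 1) by rewrite c1 c2.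
    lia.
  - have /aff_inj : u (2 * k) = u (2 * k') by rewrite c1 c2.
    lia.
(* As J permutes the classes modulo l, the sums of J k and of k over 1..l differ by a multiple of
   l. *)
have hp (k : int) : ((k + l%:Z) %% l)%Z = (k %% l)%Z by rewrite modzDr.
have := sum_periodic (h := fun k => (k %% l)%Z) JI Jp hp.
have sm (G : nat -> int) : \sum_(1 <= i < l.+1) (G i %% l)%Z =
    \sum_(1 <= i < l.+1) G i - (\sum_(1 <= i < l.+1) (G i %/ l)%Z) * l%:Z.
  by rewrite mulr_suml -sumrB; apply: eq_bigr => i _; rewrite {2}(divz_eq (G i) l) addrAC subrr add0r.
rewrite !sm => eJ.
have sp (F : nat -> int) : \sum_(1 <= i < n.+1) F i =
    \sum_(1 <= i < l.+1) (F (2 * i).-1 + F (2 * i)%N).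
  by rewrite {1}n2l sum_pairs.
have := aff_sum u; rewrite !sp.
rewrite (eq_big_nat _ _ (F2 := fun k : nat => 4 * J k%:Z + 1)); last first.
  move=> k hk; have [<- _] := uJ k%:Z; congr (u _ + u _); lia.
rewrite [RHS](eq_big_nat _ _ (F2 := fun k : nat => 4 * k%:Z - 1)); last first.
  by move=> k hk; lia.
rewrite sumrB big_split /= -!mulr_sumr !sumr_const_nat.
move: eJ; move: (\sum_(1 <= i < l.+1) J i%:Z) (\sum_(1 <= i < l.+1) i%:Z).
move: (\sum_(1 <= i < l.+1) _) (\sum_(1 <= i < l.+1) _) => q1 q2 S T eJ e4.
rewrite subn1 natz /= in e4.
have : (4 * (q2 - q1) + 2) * l%:Z = 0 by lia.
by move/eqP; rewrite mulf_eq0 => /orP [] /eqP; lia.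
Qed.

(** * Equality in the triangle inequality for sorted windows *)

Section Conjugation.
Variables (v : affperm n) (b : bool) (m : int).
Hypothesis theta_m : forall i : nat, (i < l)%N ->
  theta b (m + (2 * i).+1%:Z) = m + (2 * i).+2%:Z /\
  theta b (m + (2 * i).+2%:Z) = m + (2 * i).+1%:Z.
Hypothesis v_pair : forall i : nat, (i < l)%N ->
  v (m + (2 * i).+1%:Z) < v (m + (2 * i).+2%:Z).
(** [near x y] says exactly that F v x y = -1. The first alternative suits pairs sorted by their
    first entries, the second those sorted by their second entries. *)
Hypothesis v_sorted : forall i j : nat, (i < j)%N -> (j < l)%N ->
  let near x y := v x < v y /\ v y <= v x + n%:Z in
  near (m + (2 * i).+1%:Z) (m + (2 * j).+1%:Z) \/
  near (m + (2 * i).+2%:Z) (m + (2 * j).+2%:Z).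

(* For x < y in different pairs, F 1 = F Theta = -1, and -1 lies between F v and
   F (v Theta): one of them is -1 when x and y have the same parity offset, and
   otherwise one is <= -1 and the other >= -1. *)
Lemma disc_window (x y : nat) : (0 < x)%N -> (x < y)%N -> (y <= n)%N ->
  disc v (v * theta b)%g (m + x%:Z) (m + y%:Z) =
  disc v 1%g (m + x%:Z) (m + y%:Z) +
  disc 1%g (theta b) (m + x%:Z) (m + y%:Z) +
  disc (theta b) (v * theta b)%g (m + x%:Z) (m + y%:Z).
Proof.
move=> x0 xy yn.
have pos (k : nat) : (0 < k <= n)%N ->
    exists2 i : nat, (i < l)%N & k = (2 * i).+1 \/ k = (2 * i).+2.
  by move=> hk; exists (k.-1)./2; lia.
have [|i il ex] := pos x; first lia.
have [|j jl ey] := pos y; first lia.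
have [ti1 ti2] := theta_m i il; have [tj1 tj2] := theta_m j jl.
have vi := v_pair i il; have vj := v_pair j jl.
(* For partners x < y the chain is F v <= -1 = F 1 < F Theta = 0 <= F (v Theta). *)
have [eij|nij] := eqVneq i j.
  have {}ex : x = (2 * i).+1 by lia.
  have {}ey : y = (2 * i).+2 by lia.
  rewrite ex ey /disc !aff_mulE !aff_oneE ti1 ti2.
  have := fldiff_lt0 (v (m + (2 * i).+1%:Z)) (v (m + (2 * i).+2%:Z)).
  have := fldiff_lt0 (v (m + (2 * i).+2%:Z)) (v (m + (2 * i).+1%:Z)).
  by rewrite ![fldiff n (m + _) (m + _)]fldiff_small; lia.
have ij : (i < j)%N by lia.
have := v_sorted i j ij jl.
move: vi vj.
by case: ex => ex; case: ey => ey; rewrite ex ey /disc !aff_mulE !aff_oneE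
  ?ti1 ?ti2 ?tj1 ?tj2; rewrite ![fldiff n (m + _) (m + _)]fldiff_small; try lia;
  move: (v (m + (2 * i).+1%:Z)) (v (m + (2 * i).+2%:Z))
    (v (m + (2 * j).+1%:Z)) (v (m + (2 * j).+2%:Z)) => p p' q q' vi vj vs;
  match goal with |- context [`|fldiff n ?s ?t - fldiff n ?s' ?t'|] =>
    have := fldiff_lt0 s t; have := fldiff_lt0 s' t';
    have := fldiff_geN1 s t; have := fldiff_geN1 s' t' end; lia.
Qed.

(** The termwise equality is summed over one block starting after m. The first and last legs both
    equal [dist 1 v], the last by right invariance, and the middle leg is n. *)
Lemma dist_conj : dist v (v * theta b)%g = 2 * dist 1%g v + n%:Z.
Proof.
have -> : 2 * dist 1%g v + n%:Z =
    dist v 1%g + dist 1%g (theta b) + dist (theta b) (v * theta b)%g.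
  rewrite dist1_theta (distC v) -{1}[theta b]mul1g dist_mulr.
  by move: (dist _ _) => d; lia.
rewrite !(dist_shift _ _ m) -!big_split; apply: eq_big_nat => x hx /=.
rewrite -!big_split; apply: eq_big_nat => y hy /=.
case: (ltngtP x y) => [xy|yx|->]; last by rewrite !discxx.
  by apply: disc_window; lia.
have nd : ~~ (n %| (m + y%:Z) - (m + x%:Z))%Z.
  have := ndvdz_small (y%:Z - x%:Z) 0; rewrite mul0r addr0.
  have -> : y%:Z - x%:Z = (m + y%:Z) - (m + x%:Z) by lia.
  by apply; lia.
by rewrite !(discS _ _ _ _ nd); apply: disc_window; lia.
Qed.

End Conjugation.

(** * Representatives in 1..n and the existence of windows *)

Definition res (x : int) : int := ((x - 1) %% n)%Z + 1.

Lemma resE x : exists2 k, x = res x + k * n%:Z & 0 < res x <= n%:Z.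
Proof.
exists ((x - 1) %/ n)%Z; first by rewrite /res; have := divz_eq (x - 1) n; lia.
have := modz_ge0 (x - 1) (d := n); have := ltz_pmod (x - 1) (d := n).
rewrite /res; lia.
Qed.

Lemma resD x k : res (x + k * n%:Z) = res x.
Proof. rewrite /res; have -> : x + k * n%:Z - 1 = k * n%:Z + (x - 1) by lia.
by rewrite modzMDl. Qed.

Lemma res_id x : 0 < x <= n%:Z -> res x = x.
Proof. by move=> hx; rewrite /res modz_small ?subrK //; lia. Qed.

Lemma mem_interval x : (x \in interval1n n) = (0 < x <= n%:Z).
Proof.
apply/mapP/idP => [[k]|hx]; first by rewrite mem_iota => hk ->; lia.
by exists `|x|%N; [rewrite mem_iota|]; lia.
Qed.

Lemma interval_uniq : uniq (interval1n n).
Proof. by rewrite map_inj_uniq ?iota_uniq // => i j []. Qed.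

(** Placing c at positions m+1..m+n and extending periodically gives a bijection for any m; the sum
    condition singles out m. *)
Lemma window_spec (c : seq int) :
  perm_eq [seq res x | x <- c] (interval1n n) ->
  exists m : int, forall k, (k < n)%N -> window n c (m + k.+1%:Z) = nth 0 c k.
Proof.
move=> pc; pose P := [set p : affperm n | exists m : int,
  forall k, (k < n)%N -> p (m + k.+1%:Z) = nth 0 c k].
suff /xgetPex : exists p, P p by move/(_ 1%g).
have sc : size c = n.
  by move/perm_size: pc; rewrite !size_map size_iota.
have uc : uniq [seq res x | x <- c] by rewrite (perm_uniq pc) interval_uniq.
(* The sum of c exceeds 1 + ... + n by m n, and starting the window at m + 1 compensates for
   this. *)
pose m : int := \sum_(x <- c) ((x - 1) %/ n)%Z.
pose r (x : int) : nat := `|((x - m - 1) %% n)%Z|%N.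
pose F (x : int) : int := nth 0 c (r x) + ((x - m - 1) %/ n)%Z * n%:Z.
pose ix (y : int) : nat := index (res y) [seq res x | x <- c].
(* The inverse finds the entry of c in the class of y and translates its position by the same
   multiple of n. *)
pose G (y : int) : int := m + 1 + (ix y)%:Z + y - nth 0 c (ix y).
have n0 : n%:Z != 0 by lia.
have rE x : exists q, [/\ x = m + 1 + (r x)%:Z + q * n%:Z, (r x < n)%N
    & F x = nth 0 c (r x) + q * n%:Z].
  exists ((x - m - 1) %/ n)%Z; rewrite /F /r.
  have := modz_ge0 (x - m - 1) n0; have := ltz_pmod (x - m - 1) (d := n).
  have := divz_eq (x - m - 1) n; split=> //; lia.
have Fkq k q : (k < n)%N -> F (m + 1 + k%:Z + q * n%:Z) = nth 0 c k + q * n%:Z.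
  move=> kn; have e : m + 1 + k%:Z + q * n%:Z - m - 1 = q * n%:Z + k%:Z by lia.
  rewrite /F /r e divzMDl // modzMDl modz_small ?divz_small ?absz_nat ?addr0 //; lia.
have Fp x : F (x + n%:Z) = F x + n%:Z.
  have [q [ex rn ->]] := rE x.
  have -> : x + n%:Z = m + 1 + (r x)%:Z + (q + 1) * n%:Z by lia.
  by rewrite Fkq //; move: (nth _ _ _) => ?; lia.
have FK : cancel F G.
  move=> x; have [q [ex rn ->]] := rE x.
  rewrite /G; have -> : ix (nth 0 c (r x) + q * n%:Z) = r x.
    by rewrite /ix resD -(nth_map 0 0) ?sc // index_uniq // size_map sc.
  by rewrite [RHS]ex; lia.
have GK : cancel G F.
  move=> y.
  have iy : (ix y < n)%N.
    rewrite /ix -[X in (_ < X)%N]sc -(size_map res) index_mem (perm_mem pc).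
    by rewrite mem_interval; have [] := resE y.
  have ey : res (nth 0 c (ix y)) = res y.
    rewrite -(nth_map 0 0) ?sc // nth_index //.
    by rewrite -index_mem size_map sc.
  have [k ek _] := resE y; have [k' ek' _] := resE (nth 0 c (ix y)).
  have -> : G y = m + 1 + (ix y)%:Z + (k - k') * n%:Z.
    by rewrite /G {2}ek ek' ey; lia.
  by rewrite Fkq // {2}ek {1}ek' ey; lia.
have Fsum : \sum_(1 <= i < n.+1) F i%:Z = \sum_(1 <= i < n.+1) i%:Z.
  apply/eqP; rewrite -subr_eq0 -sumrB.
  rewrite -(sum_periodic (h := fun x => F x - x) (g := +%R m)); first last.
  - by move=> x; rewrite Fp; lia.
  - by move=> x; rewrite addrA.
  - exact: addrI.
  have sF : \sum_(1 <= i < n.+1) F (m + i%:Z) = \sum_(x <- c) x.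
    rewrite [RHS](big_nth 0) sc big_add1 /=; apply: eq_big_nat => k hk.
    by have := Fkq k 0; rewrite mul0r !addr0 => <-; [congr F|]; lia.
  have sr : \sum_(x <- c) res x = \sum_(1 <= i < n.+1) i%:Z.
    rewrite -(big_map res xpredT id) (perm_big _ pc) big_map.
    by rewrite /index_iota subn1.
  have sx : \sum_(x <- c) x = \sum_(x <- c) res x + m * n%:Z.
    rewrite /m mulr_suml -big_split; apply: eq_bigr => x _ /=.
    by rewrite /res; have := divz_eq (x - 1) n; lia.
  rewrite sumrB sF sx sr big_split /= sumr_const_nat subn1 /=.
  by rewrite -mulr_natr natz [X in _ - X]addrC subrr.
exists (@AffPerm n F G FK GK Fp Fsum), m => k kn.
have := Fkq k 0 kn; rewrite mul0r !addr0 => <-; congr F; lia.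
Qed.

Lemma nth_flatten_pairs (f g : int -> int) (s : seq int) (k : nat) :
  (k < size s)%N ->
  let c := flatten [seq [:: f a; g a] | a <- s] in
  nth 0 c (2 * k) = f (nth 0 s k) /\ nth 0 c (2 * k).+1 = g (nth 0 s k).
Proof.
elim: s k => // a s IH [|k] ks // c0.
have e : (2 * k.+1 = (2 * k).+2)%N by lia.
by rewrite /c0 e; apply: IH.
Qed.

Lemma size_flatten_pairs (f g : int -> int) (s : seq int) :
  size (flatten [seq [:: f a; g a] | a <- s]) = (2 * size s)%N.
Proof. by elim: s => //= a s ->; lia. Qed.

Lemma perm_flatten_pairs (f g : int -> int) (s : seq int) :
  perm_eq (flatten [seq [:: f a; g a] | a <- s])
    ([seq f a | a <- s] ++ [seq g a | a <- s]).
Proof.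
elim: s => //= a s IH; rewrite perm_cons perm_sym -cat1s perm_catCA cat1s.
by rewrite perm_cons perm_sym.
Qed.

Lemma sorted_interval (P : pred int) :
  sorted <%R [seq a <- interval1n n | P a].
Proof.
apply: sorted_filter; first exact: lt_trans.
rewrite /interval1n sorted_map.
by apply: sub_sorted (iota_ltn_sorted 1 n) => i j; rewrite /= ltz_nat.
Qed.

(** * Windows built from the pairs of a fixed-point-free involution *)

Section Window.
(** One setting for both extremal windows: [P a] is a < z a with (f, g) = (id, z) for the minimum,
    and z a < a with (f, g) = (z, id) for the maximum. *)
Variables (z : affperm n) (P : pred int) (f g : int -> int).
Hypothesis hz : fpf_involutions z.
Hypothesis P_period : forall x k, P (x + k * n%:Z) = P x.
Hypothesis P_z : forall x, P (z x) = ~~ P x.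
Hypothesis fg : forall a, g a = z (f a).
Hypothesis f_lt_g : forall a, P a -> f a < g a.
Hypothesis f_or_g : (forall a, f a = a) \/ (forall a, g a = a).

Let zK x : z (z x) = x.
Proof. by have [] := hz x. Qed.

Let S := [seq a <- interval1n n | P a].
Let c := flatten [seq [:: f a; g a] | a <- S].

Lemma mem_S x : (x \in S) = P x && (0 < x <= n%:Z).
Proof. by rewrite mem_filter mem_interval. Qed.

(** [P] depends only on the class modulo n, and z exchanges the classes satisfying [P] with the
    others. *)
Lemma perm_half : perm_eq (S ++ [seq res (z a) | a <- S]) (interval1n n).
Proof.
have Pres x : P (res x) = P x.
  by have [k e _] := resE x; rewrite {2}e P_period.
have zM := periodM (@aff_period n z).
have zres x : res (z (res x)) = res (z x).
  by have [k e _] := resE x; rewrite {2}e zM resD.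
have zzres x : res (z (res (z x))) = res x by rewrite zres zK.
apply: uniq_perm; rewrite ?interval_uniq // ?cat_uniq.
  rewrite filter_uniq ?interval_uniq //= map_inj_in_uniq.
    rewrite filter_uniq ?interval_uniq // andbT; apply/hasPn => x /mapP [a].
    by rewrite !mem_S => /andP [Pa _] ->; rewrite Pres P_z Pa.
  move=> a a'; rewrite !mem_S => /andP [_ ha] /andP [_ ha'] e.
  by rewrite -(res_id a) // -(res_id a') // -zzres e zzres.
move=> x; rewrite mem_cat mem_S mem_interval.
apply/orP/idP => [[/andP [] //|/mapP [a _ ->]]|hx].
  by have [] := resE (z a).
have [Px|nPx] := boolP (P x); [by left; rewrite hx|right].
apply/mapP; exists (res (z x)); last by rewrite zzres res_id.
by rewrite mem_S Pres P_z nPx; have [] := resE (z x).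
Qed.

Lemma perm_window : perm_eq [seq res x | x <- c] (interval1n n).
Proof.
apply: perm_trans perm_half.
apply: perm_trans (perm_map res (perm_flatten_pairs f g S)) _.
rewrite map_cat -!map_comp.
have resS : [seq res a | a <- S] = S.
  rewrite -[RHS]map_id; apply/eq_in_map => a; rewrite mem_S => /andP [_].
  exact: res_id.
case: f_or_g => h.
  have -> : map (res \o f) S = S.
    by rewrite -[RHS]resS; apply: eq_map => a /=; rewrite h.
  have -> : map (res \o g) S = [seq res (z a) | a <- S].
    by apply: eq_map => a /=; rewrite fg h.
  exact: perm_refl.
have -> : map (res \o g) S = S.
  by rewrite -[RHS]resS; apply: eq_map => a /=; rewrite h.
have -> : map (res \o f) S = [seq res (z a) | a <- S].
  by apply: eq_map => a /=; rewrite -{2}(h a) fg zK.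
by rewrite perm_catC perm_refl.
Qed.

Lemma window_conj : exists b, (z * window n c = window n c * theta b)%g /\
  dist 1%g z = 2 * dist 1%g (window n c) + n%:Z.
Proof.
have [m vE] := window_spec c perm_window.
set v := window n c in vE *.
have sS : size S = l.
  have := perm_size perm_window.
  by rewrite size_map size_flatten_pairs size_map size_iota; lia.
(* The parity of m decides which Theta swaps the two positions of each window pair. *)
have [b /dvdzP [u eu]] : exists b : bool, (2 %| m - b%:Z)%Z.
  have [h|h] := parityP true m; first by exists true.
  by exists false; rewrite addrK in h; rewrite subr0.
have v1 i : (i < l)%N -> v (m + (2 * i).+1%:Z) = f (nth 0 S i).
  by move=> il; rewrite vE; [have [] := nth_flatten_pairs f g S i; rewrite ?sS|lia].
have v2 i : (i < l)%N -> v (m + (2 * i).+2%:Z) = g (nth 0 S i).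
  by move=> il; rewrite vE; [have [] := nth_flatten_pairs f g S i; rewrite ?sS|lia].
have th i : theta b (m + (2 * i).+1%:Z) = m + (2 * i).+2%:Z /\
    theta b (m + (2 * i).+2%:Z) = m + (2 * i).+1%:Z.
  have [e1 e2] := thetaP b (u + i%:Z + 1).
  have -> : m + (2 * i).+2%:Z = 2 * (u + i%:Z + 1) + b%:Z by lia.
  by have -> : m + (2 * i).+1%:Z = 2 * (u + i%:Z + 1) + b%:Z - 1 by lia.
have SP i : (i < l)%N -> P (nth 0 S i) && (0 < nth 0 S i <= n%:Z).
  by move=> il; rewrite -mem_S mem_nth ?sS.
have zv : (z * v = v * theta b)%g.
  apply: affpermP => x; rewrite !aff_mulE.
  have [k ex hr] := resE (x - m).
  pose i := (`|res (x - m)|.-1)./2.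
  have il : (i < l)%N by lia.
  have [t1 t2] := th i.
  have e : x = m + (2 * i).+1%:Z + k * n%:Z \/ x = m + (2 * i).+2%:Z + k * n%:Z.
    by rewrite /i; lia.
  have pM w := periodM (@aff_period n w).
  case: e => ->; rewrite !pM ?t1 ?t2 ?v1 ?v2 // fg //.
  by rewrite zK.
exists b; split=> //.
have -> : dist 1%g z = dist v (v * theta b)%g.
  by rewrite -zv -{1}[v]mul1g dist_mulr.
apply: (dist_conj v b m) => [i _|i il|i j ij jl /=]; first exact: th.
  by rewrite v1 // v2 //; apply: f_lt_g; have /andP [] := SP i il.
have il : (i < l)%N by lia.
(* The sorted coordinate takes values in 1..n, so its increase is also less than n. *)
have lt_ij : nth 0 S i < nth 0 S j.
  by apply: (sorted_ltn_nth lt_trans 0 (sorted_interval P)); rewrite ?inE ?sS.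
have /andP [_ hi] := SP i il; have /andP [_ hj] := SP j jl.
by case: f_or_g => h; [left; rewrite !v1 // !h|right; rewrite !v2 // !h]; lia.
Qed.

End Window.

(** * The lower bound for conjugators and its consequences for atoms *)

Lemma dist_conj_le (z w : affperm n) b : (w^-1 * theta b * w = z)%g ->
  dist 1%g z <= 2 * dist 1%g w + n%:Z.
Proof.
move=> <-; apply: (le_trans (dist1M _ _)).
have := dist1M (w^-1)%g (theta b); rewrite dist1V dist1_theta.
by move: (dist 1%g w) (dist 1%g (_ * _)%g) => d d'; lia.
Qed.

Lemma atoms_fpfE (z w : affperm n) : atoms_fpf z w <->
  exists b, (w^-1 * theta b * w = z)%g /\
    forall v, (v^-1 * theta b * v = z)%g -> (ell w <= ell v)%N.
Proof.
split=> [[T]|[b h]]; last first.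
  by exists (theta b) => //; case: b {h}; rewrite !inE eqxx ?orbT.
by rewrite !inE => /orP [] /eqP -> h; [exists false|exists true].
Qed.

(** Equality in the bound makes w shortest among the conjugators from both Thetas. *)
Lemma optimal_atom (z w : affperm n) b : (w^-1 * theta b * w = z)%g ->
  dist 1%g z = 2 * dist 1%g w + n%:Z ->
  atoms_fpf z w /\ forall w', atoms_fpf z w' -> ell w' = ell w.
Proof.
move=> zw dz; have le_w v b' : (v^-1 * theta b' * v = z)%g -> (ell w <= ell v)%N.
  by move/dist_conj_le; rewrite dz !dist_ell //; lia.
split=> [|w' /atoms_fpfE [b' [zw' minw']]].
  by apply/atoms_fpfE; exists b; split=> // v; apply: le_w.
apply/eqP; rewrite eqn_leq (le_w w' b') // andbT; apply: minw'.
(* Minimality of w' only concerns conjugators from [theta b'], so w is a competitor once the two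
   Thetas agree. *)
suff -> : b' = b by [].
(* Otherwise w2 w1^-1 would conjugate one Theta into the other. *)
have key (w1 w2 : affperm n) : (w1^-1 * theta false * w1)%g = z ->
    (w2^-1 * theta true * w2)%g = z -> False.
  move=> e1 e2; apply: (theta_not_conj (w2 * w1^-1)%g).
  have {}e1 : (w1^-1 * theta false)%g = (z * w1^-1)%g.
    by rewrite -e1 -mulgA mulgV mulg1.
  by rewrite -mulgA e1 -e2 !mulgA mulgV mul1g.
by case: b b' zw zw' {dz le_w} => [] [] // h h'; [case: (key _ _ h' h)|case: (key _ _ h h')].
Qed.

End AffinePermutations.

Theorem theorem3p6 (n : nat) (hn : (2 <= n)%N) (n_even : ~~ odd n)
    (z : affperm n) (hz : fpf_involutions z) :
  (forall w : affperm n, atoms_fpf z w -> (ell w)%:R = ellhat_fpf z) /\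
  [set alpha_min_fpf z; alpha_max_fpf z] `<=` atoms_fpf z.
Proof.
have zK x : z (z x) = x by have [] := hz x.
have zN x : z x != x by have [_ /eqP] := hz x; rewrite eq_sym.
have zM := periodM (@aff_period n z).
(* A window v gives z = v Theta v^-1, so the candidate atom is v^-1, at the same distance from 1. *)
have Vatom v b : (z * v = v * theta n b)%g ->
    dist n 1%g z = 2 * dist n 1%g v + n%:Z ->
    [/\ atoms_fpf z (v^-1)%g,
        forall w, atoms_fpf z w -> ell w = ell (v^-1)%g &
        dist n 1%g z = 2 * dist n 1%g (v^-1)%g + n%:Z].
  move=> zv dz; rewrite dist1V //.
  have e : (v^-1^-1 * theta n b * v^-1)%g = z by rewrite invgK -zv -mulgA mulgV mulg1.
  have dz' : dist n 1%g z = 2 * dist n 1%g (v^-1)%g + n%:Z by rewrite dist1V.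
  by have [] := optimal_atom n hn n_even z _ b e dz'.
have up_period x k : (x + k * n%:Z < z (x + k * n%:Z)) = (x < z x).
  by rewrite zM; lia.
have up_z x : (z x < z (z x)) = ~~ (x < z x) by rewrite zK; have := zN x; lia.
have down_period x k : (z (x + k * n%:Z) < x + k * n%:Z) = (z x < x).
  by rewrite zM; lia.
have down_z x : (z (z x) < z x) = ~~ (z x < x) by rewrite zK; have := zN x; lia.
have [b [zv dz]] := window_conj n hn n_even z (fun a => a < z a) id z hz
  up_period up_z (fun=> erefl) (fun _ => id) (or_introl (fun=> erefl)).
have [b' [zv' dz']] := window_conj n hn n_even z (fun d => z d < d) z id hz
  down_period down_z (fun a => esym (zK a)) (fun _ => id) (or_intror (fun=> erefl)).
have [atom_min ell_eq dist_eq] := Vatom _ _ zv dz.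
have [atom_max _ _] := Vatom _ _ zv' dz'.
split=> [w /ell_eq ->|w [->|->] //].
rewrite !dist_ell // in dist_eq.
have {}dist_eq : (ell z = 2 * ell (alpha_min_fpf z) + n./2)%N.
  by move: dist_eq; rewrite -/(alpha_min_fpf z); lia.
(* As n is even, the rational n / 2 in [ellhat_fpf] is the natural number [n./2]. *)
have n2 : n%:R = 2 * n./2%:R :> rat by rewrite -natrM mul2n even_halfK.
by rewrite /ellhat_fpf dist_eq n2 natrD natrM; lra.
Qed.
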